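(* Let $\mathbb{F}$ be a field of characteristic 0, and in the free dendriform dialgebra over $\mathbb{F}$ write $a\cdot b=a\succ b+b\prec a$. Let $J\subset\mathrm{DD}_3$ be the $S_3$-submodule generated by the two trilinear operations $$(a\cdot b)\cdot c+a\cdot(b\cdot c)-(a\cdot c)\cdot b,\qquad (a\cdot b)\cdot c+a\cdot(b\cdot c)-b\cdot(c\cdot a).$$ Then $\dim J=12$, and hence these two operations satisfy no identities in degree 3 (that is, the 12 elements of $\mathrm{DD}_3$ obtained by applying the 6 permutations of $a,b,c$ to the two operations are linearly independent).
   Context: A dendriform dialgebra over $\mathbb{F}$ is a vector space with two bilinear operations $\prec,\succ$ satisfying, for all $x,y,z$: $(x\succ y)\prec z = x\succ(y\prec z)$; $(x\prec y)\prec z = x\prec(y\prec z)+x\prec(y\succ z)$; $x\succ(y\succ z)=(x\succ y)\succ z+(x\prec y)\succ z$. $\mathrm{DD}_3$ denotes the multilinear subspace of degree 3 of the free dendriform dialgebra over $\mathbb{F}$ on three generators $a,b,c$ (each generator occurring exactly once in each monomial), with $S_3$ acting by permuting the generators. *)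

(* Defs.v *)
From HB Require Import structures.
From mathcomp Require Import perm.
From mathcomp Require Import all_boot all_order all_algebra.
From mathcomp Require Import boolp.

Set Implicit Arguments.
Unset Strict Implicit.
Unset Printing Implicit Defensive.

Import GRing.Theory.
Local Open Scope ring_scope.
Local Open Scope quotient_scope.

Reserved Notation "x ≺ y" (at level 40, left associativity).
Reserved Notation "x ≻ y" (at level 40, left associativity).
Reserved Notation "x ⋅ y" (at level 40, left associativity).

HB.mixin Record isDendriform (F : fieldType) V of GRing.Lmodule F V := {
  dprec : V -> V -> V;
  dsucc : V -> V -> V;
  dprec_linl : forall y, linear (dprec^~ y);
  dprec_linr : forall x, linear (dprec x);
  dsucc_linl : forall y, linear (dsucc^~ y);
  dsucc_linr : forall x, linear (dsucc x);
  dsucc_prec : forall x y z, dprec (dsucc x y) z = dsucc x (dprec y z);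
  dprec_prec : forall x y z,
    dprec (dprec x y) z = dprec x (dprec y z) + dprec x (dsucc y z);
  dsucc_succ : forall x y z,
    dsucc x (dsucc y z) = dsucc (dsucc x y) z + dsucc (dprec x y) z
}.

#[short(type="dendriformType")]
HB.structure Definition Dendriform (F : fieldType) :=
  {V of isDendriform F V & GRing.Lmodule F V}.

Notation "x ≺ y" := (dprec x y) : ring_scope.
Notation "x ≻ y" := (dsucc x y) : ring_scope.

Definition dendriform_morphism (F : fieldType) (D E : dendriformType F)
    (f : D -> E) : Prop :=
  [/\ linear f, {morph f : x y / x ≺ y} & {morph f : x y / x ≻ y}].

(* The free dendriform dialgebra on X is built as formal expressions modulo the
   least congruence containing the axioms; see free_dendriformP below for its
   universal property. *)
Inductive dterm (F : fieldType) (X : Type) : Type :=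
| TGen of X
| TZero
| TAdd of dterm F X & dterm F X
| TScale of F & dterm F X
| TPrec of dterm F X & dterm F X
| TSucc of dterm F X & dterm F X.

Arguments TGen {F X}.
Arguments TZero {F X}.

Inductive deq (F : fieldType) (X : Type) : dterm F X -> dterm F X -> Prop :=
| deq_refl t : deq t t
| deq_sym t u : deq t u -> deq u t
| deq_trans t u v : deq t u -> deq u v -> deq t v
| deq_add t t' u u' : deq t t' -> deq u u' -> deq (TAdd t u) (TAdd t' u')
| deq_scale k t t' : deq t t' -> deq (TScale k t) (TScale k t')
| deq_prec t t' u u' : deq t t' -> deq u u' -> deq (TPrec t u) (TPrec t' u')
| deq_succ t t' u u' : deq t t' -> deq u u' -> deq (TSucc t u) (TSucc t' u')
| deq_addA t u v : deq (TAdd t (TAdd u v)) (TAdd (TAdd t u) v)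
| deq_addC t u : deq (TAdd t u) (TAdd u t)
| deq_add0 t : deq (TAdd TZero t) t
| deq_addN t : deq (TAdd (TScale (-1) t) t) TZero
| deq_scaleA k l t : deq (TScale k (TScale l t)) (TScale (k * l) t)
| deq_scale1 t : deq (TScale 1 t) t
| deq_scaleDr k t u :
    deq (TScale k (TAdd t u)) (TAdd (TScale k t) (TScale k u))
| deq_scaleDl k l t :
    deq (TScale (k + l) t) (TAdd (TScale k t) (TScale l t))
| deq_prec_linl k t u v :
    deq (TPrec (TAdd (TScale k t) u) v)
        (TAdd (TScale k (TPrec t v)) (TPrec u v))
| deq_prec_linr k t u v :
    deq (TPrec v (TAdd (TScale k t) u))
        (TAdd (TScale k (TPrec v t)) (TPrec v u))
| deq_succ_linl k t u v :
    deq (TSucc (TAdd (TScale k t) u) v)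
        (TAdd (TScale k (TSucc t v)) (TSucc u v))
| deq_succ_linr k t u v :
    deq (TSucc v (TAdd (TScale k t) u))
        (TAdd (TScale k (TSucc v t)) (TSucc v u))
| deq_succ_prec t u v : deq (TPrec (TSucc t u) v) (TSucc t (TPrec u v))
| deq_prec_prec t u v :
    deq (TPrec (TPrec t u) v) (TAdd (TPrec t (TPrec u v)) (TPrec t (TSucc u v)))
| deq_succ_succ t u v :
    deq (TSucc t (TSucc u v))
        (TAdd (TSucc (TSucc t u) v) (TSucc (TPrec t u) v)).

HB.instance Definition _ (F : fieldType) (X : Type) :=
  gen_eqMixin (dterm F X).
HB.instance Definition _ (F : fieldType) (X : Type) :=
  gen_choiceMixin (dterm F X).

Section FreeDendriform.
Variables (F : fieldType) (X : Type).
Implicit Types t u v : dterm F X.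

Definition deqb t u : bool := `[< deq t u >].

Lemma deqb_refl : reflexive deqb.
Proof. by move=> t; apply/asboolP; apply: deq_refl. Qed.

Lemma deqb_sym : symmetric deqb.
Proof. by move=> t u; apply/asboolP/asboolP; apply: deq_sym. Qed.

Lemma deqb_trans : transitive deqb.
Proof. by move=> u t v /asboolP h /asboolP h'; apply/asboolP; apply: deq_trans h'. Qed.

Canonical deqb_equiv := EquivRel deqb deqb_refl deqb_sym deqb_trans.

Definition free_dendriform : Type := {eq_quot deqb}.

HB.instance Definition _ := Choice.on free_dendriform.
HB.instance Definition _ := EqQuotient.on free_dendriform.

Local Notation FD := free_dendriform.
Local Notation cls := (\pi_FD).

Lemma clsP t u : cls t = cls u <-> deq t u.
Proof.
split; first by move/eqmodP => /asboolP.
by move=> h; apply/eqmodP/asboolP.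
Qed.

Lemma deq_repr t : deq (repr (cls t)) t.
Proof. by apply/clsP; rewrite reprK. Qed.

Lemma clsW (P : FD -> Prop) : (forall t, P (cls t)) -> forall x, P x.
Proof. by move=> Pt x; rewrite -[x](@reprK _ FD). Qed.

Definition fgen (x : X) : FD := cls (TGen x).
Definition fzero : FD := cls TZero.
Definition fadd (x y : FD) : FD := cls (TAdd (repr x) (repr y)).
Definition fscale (k : F) (x : FD) : FD := cls (TScale k (repr x)).
Definition fprec (x y : FD) : FD := cls (TPrec (repr x) (repr y)).
Definition fsucc (x y : FD) : FD := cls (TSucc (repr x) (repr y)).

Lemma faddE t u : fadd (cls t) (cls u) = cls (TAdd t u).
Proof. by apply/clsP; apply: deq_add; apply: deq_repr. Qed.
Lemma fscaleE k t : fscale k (cls t) = cls (TScale k t).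
Proof. by apply/clsP; apply: deq_scale; apply: deq_repr. Qed.
Lemma fprecE t u : fprec (cls t) (cls u) = cls (TPrec t u).
Proof. by apply/clsP; apply: deq_prec; apply: deq_repr. Qed.
Lemma fsuccE t u : fsucc (cls t) (cls u) = cls (TSucc t u).
Proof. by apply/clsP; apply: deq_succ; apply: deq_repr. Qed.

Let fE := (faddE, fscaleE, fprecE, fsuccE).

Fact faddA : associative fadd.
Proof.
by elim/clsW=> t; elim/clsW=> u; elim/clsW=> v; rewrite !fE; apply/clsP; apply: deq_addA.
Qed.
Fact faddC : commutative fadd.
Proof. by elim/clsW=> t; elim/clsW=> u; rewrite !fE; apply/clsP; apply: deq_addC. Qed.
Fact fadd0 : left_id fzero fadd.
Proof. by elim/clsW=> t; rewrite fE; apply/clsP; apply: deq_add0. Qed.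
Fact faddN : left_inverse fzero (fscale (-1)) fadd.
Proof. by elim/clsW=> t; rewrite !fE; apply/clsP; apply: deq_addN. Qed.

HB.instance Definition _ := GRing.isZmodule.Build FD faddA faddC fadd0 faddN.

Fact fscaleA k l (x : FD) : fscale k (fscale l x) = fscale (k * l) x.
Proof. by elim/clsW: x => t; rewrite !fE; apply/clsP; apply: deq_scaleA. Qed.
Fact fscale1 : left_id 1 fscale.
Proof. by elim/clsW=> t; rewrite !fE; apply/clsP; apply: deq_scale1. Qed.
Fact fscaleDr : right_distributive fscale +%R.
Proof.
by move=> k; elim/clsW=> t; elim/clsW=> u; rewrite /GRing.add /= !fE; apply/clsP; apply: deq_scaleDr.
Qed.
Fact fscaleDl (x : FD) : {morph fscale^~ x : k l / k + l}.
Proof.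
by elim/clsW: x => t k l; rewrite /= [RHS]/GRing.add /= !fE; apply/clsP; apply: deq_scaleDl.
Qed.

HB.instance Definition _ :=
  GRing.Zmodule_isLmodule.Build F FD fscaleA fscale1 fscaleDr fscaleDl.

Lemma flinE k t u : k *: cls t + cls u = cls (TAdd (TScale k t) u).
Proof. by rewrite /GRing.scale /GRing.add /= !fE. Qed.
Lemma faddrE t u : cls t + cls u = cls (TAdd t u).
Proof. exact: faddE. Qed.

Fact fprec_linl y : linear (fprec^~ y).
Proof.
elim/clsW: y => v k; elim/clsW=> t; elim/clsW=> u.
by rewrite /= !(flinE, fE); apply/clsP; apply: deq_prec_linl.
Qed.
Fact fprec_linr x : linear (fprec x).
Proof.
elim/clsW: x => v k; elim/clsW=> t; elim/clsW=> u.
by rewrite /= !(flinE, fE); apply/clsP; apply: deq_prec_linr.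
Qed.
Fact fsucc_linl y : linear (fsucc^~ y).
Proof.
elim/clsW: y => v k; elim/clsW=> t; elim/clsW=> u.
by rewrite /= !(flinE, fE); apply/clsP; apply: deq_succ_linl.
Qed.
Fact fsucc_linr x : linear (fsucc x).
Proof.
elim/clsW: x => v k; elim/clsW=> t; elim/clsW=> u.
by rewrite /= !(flinE, fE); apply/clsP; apply: deq_succ_linr.
Qed.
Fact fsucc_prec x y z : fprec (fsucc x y) z = fsucc x (fprec y z).
Proof.
elim/clsW: x => t; elim/clsW: y => u; elim/clsW: z => v.
by rewrite !fE; apply/clsP; apply: deq_succ_prec.
Qed.
Fact fprec_prec x y z :
  fprec (fprec x y) z = fprec x (fprec y z) + fprec x (fsucc y z).
Proof.
elim/clsW: x => t; elim/clsW: y => u; elim/clsW: z => v.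
by rewrite !fE faddrE; apply/clsP; apply: deq_prec_prec.
Qed.
Fact fsucc_succ x y z :
  fsucc x (fsucc y z) = fsucc (fsucc x y) z + fsucc (fprec x y) z.
Proof.
elim/clsW: x => t; elim/clsW: y => u; elim/clsW: z => v.
by rewrite !fE faddrE; apply/clsP; apply: deq_succ_succ.
Qed.

HB.instance Definition _ := isDendriform.Build F FD
  fprec_linl fprec_linr fsucc_linl fsucc_linr fsucc_prec fprec_prec fsucc_succ.

Section Lift.
Variables (D : dendriformType F) (h : X -> D).

Fixpoint teval t : D :=
  match t with
  | TGen x => h x
  | TZero => 0
  | TAdd t u => teval t + teval u
  | TScale k t => k *: teval t
  | TPrec t u => teval t ≺ teval u
  | TSucc t u => teval t ≻ teval u
  end.

Lemma teval_deq t u : deq t u -> teval t = teval u.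
Proof.
elim=> {t u} //=.
- by move=> t u v _ -> _ ->.
- by move=> t t' u u' _ -> _ ->.
- by move=> k t t' _ ->.
- by move=> t t' u u' _ -> _ ->.
- by move=> t t' u u' _ -> _ ->.
- by move=> t u v; rewrite addrA.
- by move=> t u; rewrite addrC.
- by move=> t; rewrite add0r.
- by move=> t; rewrite scaleN1r addNr.
- by move=> k l t; rewrite scalerA.
- by move=> t; rewrite scale1r.
- by move=> k t u; rewrite scalerDr.
- by move=> k l t; rewrite scalerDl.
- by move=> k t u v; rewrite dprec_linl.
- by move=> k t u v; rewrite dprec_linr.
- by move=> k t u v; rewrite dsucc_linl.
- by move=> k t u v; rewrite dsucc_linr.
- by move=> t u v; rewrite dsucc_prec.
- by move=> t u v; rewrite dprec_prec.
- by move=> t u v; rewrite dsucc_succ.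
Qed.

Definition free_lift (x : FD) : D := teval (repr x).

Lemma free_liftE t : free_lift (cls t) = teval t.
Proof. exact/teval_deq/deq_repr. Qed.

Lemma free_lift_gen x : free_lift (fgen x) = h x.
Proof. by rewrite free_liftE. Qed.

Lemma free_lift_morphism : dendriform_morphism free_lift.
Proof.
split=> [k|x y|x y].
- by elim/clsW=> t; elim/clsW=> u; rewrite flinE !free_liftE.
- elim/clsW: x => t; elim/clsW: y => u.
  by rewrite [cls t ≺ cls u]fprecE !free_liftE.
- elim/clsW: x => t; elim/clsW: y => u.
  by rewrite [cls t ≻ cls u]fsuccE !free_liftE.
Qed.

Lemma free_lift_unique (f : FD -> D) :
  dendriform_morphism f -> (forall x, f (fgen x) = h x) -> f =1 free_lift.
Proof.
move=> [flin fP fS] fh; elim/clsW=> t; rewrite free_liftE.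
have f0 : f 0 = 0.
  by have := flin (-1) 0 0; rewrite scaleN1r addNr scaleN1r addNr.
elim: t => [x||t IHt u IHu|k t IHt|t IHt u IHu|t IHt u IHu] /=.
- exact: fh.
- exact: f0.
- by rewrite -IHt -IHu -faddrE -{1}[cls t]scale1r flin scale1r.
- by rewrite -IHt -fscaleE -[fscale k _]addr0 flin f0 addr0.
- by rewrite -IHt -IHu -fP; congr f; rewrite [RHS]fprecE.
- by rewrite -IHt -IHu -fS; congr f; rewrite [RHS]fsuccE.
Qed.

End Lift.

Theorem free_dendriformP (D : dendriformType F) (h : X -> D) :
  exists f : FD -> D,
    [/\ dendriform_morphism f, forall x, f (fgen x) = h x &
        forall g : FD -> D, dendriform_morphism g ->
          (forall x, g (fgen x) = h x) -> g =1 f].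
Proof.
exists (free_lift h); split.
- exact: free_lift_morphism.
- exact: free_lift_gen.
- exact: free_lift_unique.
Qed.

End FreeDendriform.

Arguments fgen {F X}.

Inductive monomial (X : Type) : Type :=
| MGen of X
| MPrec of monomial X & monomial X
| MSucc of monomial X & monomial X.

Fixpoint leaves (X : Type) (m : monomial X) : seq X :=
  match m with
  | MGen x => [:: x]
  | MPrec m1 m2 | MSucc m1 m2 => leaves m1 ++ leaves m2
  end.

Fixpoint meval (F : fieldType) (D : dendriformType F) (X : Type) (h : X -> D)
    (m : monomial X) : D :=
  match m with
  | MGen x => h x
  | MPrec m1 m2 => meval h m1 ≺ meval h m2
  | MSucc m1 m2 => meval h m1 ≻ meval h m2
  end.

Section LinearAlgebra.
Variables (F : fieldType) (V : lmodType F).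

Definition subspace (P : V -> Prop) : Prop :=
  P 0 /\ forall (k : F) (u v : V), P u -> P v -> P (k *: u + v).

Definition lin_span (A : V -> Prop) (v : V) : Prop :=
  forall P : V -> Prop, subspace P -> (forall u, A u -> P u) -> P v.

Definition lin_indep (I : finType) (e : I -> V) : Prop :=
  forall c : I -> F, \sum_i c i *: e i = 0 -> forall i, c i = 0.

Definition has_dim (W : V -> Prop) (n : nat) : Prop :=
  exists e : 'I_n -> V, lin_indep e /\
    forall v, W v <-> exists c : 'I_n -> F, v = \sum_i c i *: e i.

End LinearAlgebra.

Section Multilinear.
Variables (F : fieldType) (n : nat).
Local Notation FD := (free_dendriform F 'I_n).

Definition DD : FD -> Prop :=
  lin_span (fun v => exists m : monomial 'I_n,
    perm_eq (leaves m) (enum 'I_n) /\ v = meval fgen m).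

Definition perm_act (s : 'S_n) : FD -> FD := free_lift (fun i => fgen (s i)).

Definition Sn_submodule (P : FD -> Prop) : Prop :=
  [/\ subspace P, forall v, P v -> DD v &
      forall (s : 'S_n) v, P v -> P (perm_act s v)].

Definition Sn_generated (A : FD -> Prop) (v : FD) : Prop :=
  forall P : FD -> Prop, Sn_submodule P -> (forall u, A u -> P u) -> P v.

Lemma meval_perm_act (s : 'S_n) (m : monomial 'I_n) :
  exists m' : monomial 'I_n, leaves m' = map s (leaves m) /\
    perm_act s (meval fgen m) = meval fgen m'.
Proof.
have [_ fP fS] := free_lift_morphism (fun i => fgen (s i) : FD).
elim: m => [x|m1 [m1' [l1 e1]] m2 [m2' [l2 e2]]|m1 [m1' [l1 e1]] m2 [m2' [l2 e2]]].
- by exists (MGen (s x)); split=> //=; rewrite /perm_act free_lift_gen.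
- exists (MPrec m1' m2'); rewrite /= map_cat l1 l2; split=> //.
  by rewrite -e1 -e2; apply: fP.
- exists (MSucc m1' m2'); rewrite /= map_cat l1 l2; split=> //.
  by rewrite -e1 -e2; apply: fS.
Qed.

Lemma DD_submodule : Sn_submodule DD.
Proof.
split=> [|//|s v].
  by split=> [P [P0 _] _ //|k u v Du Dv P sP hP]; apply: sP.2; [apply: Du|apply: Dv].
have [flin _ _] := free_lift_morphism (fun i => fgen (s i) : FD).
move=> Dv; apply: (Dv (fun v => DD (perm_act s v))).
  split=> [|k u w Du Dw].
    have := flin (-1) 0 0; rewrite scaleN1r addNr scaleN1r addNr => e.
    by rewrite /perm_act e => P [P0 _].
  rewrite /perm_act flin => P sP hP.
  by apply: sP.2; [apply: Du|apply: Dw].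
move=> _ [m [lm ->]]; have [m' [lm' ->]] := meval_perm_act s m.
move=> P _; apply; exists m'; split=> //.
rewrite lm' uniq_perm ?enum_uniq //.
  by rewrite (map_inj_uniq perm_inj) (perm_uniq lm) enum_uniq.
move=> i; rewrite mem_enum -[i](permKV s) (mem_map perm_inj) (perm_mem lm).
by rewrite mem_enum.
Qed.

Lemma Sn_generated_submodule (A : FD -> Prop) :
  (forall v, A v -> DD v) -> Sn_submodule (Sn_generated A).
Proof.
move=> AD; split=> [|v|s v Av P sP hP].
- split=> [P [[P0 _] _ _] _ //|k u v Au Av P sP hP].
  by case: (sP) => [[_ lP] _ _]; apply: lP; [apply: Au|apply: Av].
- by apply=> //; apply: DD_submodule.
- by case: (sP) => _ _; apply; apply: Av.
Qed.

End Multilinear.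

Section Operations.
Variables (F : fieldType) (D : dendriformType F).
Implicit Types a b c : D.

Definition ddot a b : D := a ≻ b + b ≺ a.
Local Notation "x ⋅ y" := (ddot x y) : ring_scope.

Definition op1 a b c : D := (a ⋅ b) ⋅ c + a ⋅ (b ⋅ c) - (a ⋅ c) ⋅ b.
Definition op2 a b c : D := (a ⋅ b) ⋅ c + a ⋅ (b ⋅ c) - b ⋅ (c ⋅ a).

End Operations.

Section Degree3.
Variable F : fieldType.
Local Notation FD := (free_dendriform F 'I_3).

(* The generators a, b, c are indexed by 0, 1, 2. *)
Definition ga : FD := fgen (inord 0).
Definition gb : FD := fgen (inord 1).
Definition gc : FD := fgen (inord 2).

Definition f1 : FD := op1 ga gb gc.
Definition f2 : FD := op2 ga gb gc.

Lemma DD3_monomial (m : monomial 'I_3) :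
  uniq (leaves m) -> size (leaves m) = 3 -> DD (meval fgen m : FD).
Proof.
move=> Um Sm P _; apply; exists m; split=> //.
apply: uniq_perm; rewrite ?enum_uniq //.
have := @uniq_min_size _ (leaves m) (enum 'I_3) Um.
rewrite size_enum_ord Sm leqnn => h; apply: (h _ isT).2 => i _.
by rewrite mem_enum.
Qed.

Lemma DDD (u v : FD) : DD u -> DD v -> DD (u + v).
Proof.
have [[_ h] _ _] := DD_submodule F 3.
by move=> Du Dv; rewrite -[u]scale1r; apply: h.
Qed.

Lemma DDB (u v : FD) : DD u -> DD v -> DD (u - v).
Proof.
have [[_ h] _ _] := DD_submodule F 3.
by move=> Du Dv; rewrite addrC -scaleN1r; apply: h.
Qed.

Lemma dprecDl (x y z : FD) : (x + y) ≺ z = x ≺ z + y ≺ z.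
Proof. by have := dprec_linl z 1 x y; rewrite !scale1r. Qed.
Lemma dprecDr (x y z : FD) : z ≺ (x + y) = z ≺ x + z ≺ y.
Proof. by have := dprec_linr z 1 x y; rewrite !scale1r. Qed.
Lemma dsuccDl (x y z : FD) : (x + y) ≻ z = x ≻ z + y ≻ z.
Proof. by have := dsucc_linl z 1 x y; rewrite !scale1r. Qed.
Lemma dsuccDr (x y z : FD) : z ≻ (x + y) = z ≻ x + z ≻ y.
Proof. by have := dsucc_linr z 1 x y; rewrite !scale1r. Qed.

Lemma DD_ddotl (x y z : 'I_3) : uniq [:: x; y; z] ->
  DD (ddot (ddot (fgen x) (fgen y)) (fgen z) : FD).
Proof.
rewrite /= !inE !negb_or andbT => /andP[/andP[xy xz] yz].
have [yx zx zy] : [/\ y != x, z != x & z != y] by rewrite ![_ == x]eq_sym [z == y]eq_sym.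
rewrite /ddot dprecDr dsuccDl.
do !apply: DDD.
- by apply: (@DD3_monomial (MSucc (MSucc (MGen x) (MGen y)) (MGen z)));
    rewrite /= ?inE ?negb_or ?xy ?yx ?xz ?zx ?yz ?zy.
- by apply: (@DD3_monomial (MSucc (MPrec (MGen y) (MGen x)) (MGen z)));
    rewrite /= ?inE ?negb_or ?xy ?yx ?xz ?zx ?yz ?zy.
- by apply: (@DD3_monomial (MPrec (MGen z) (MSucc (MGen x) (MGen y))));
    rewrite /= ?inE ?negb_or ?xy ?yx ?xz ?zx ?yz ?zy.
- by apply: (@DD3_monomial (MPrec (MGen z) (MPrec (MGen y) (MGen x))));
    rewrite /= ?inE ?negb_or ?xy ?yx ?xz ?zx ?yz ?zy.
Qed.

Lemma DD_ddotr (x y z : 'I_3) : uniq [:: x; y; z] ->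
  DD (ddot (fgen x) (ddot (fgen y) (fgen z)) : FD).
Proof.
rewrite /= !inE !negb_or andbT => /andP[/andP[xy xz] yz].
have [yx zx zy] : [/\ y != x, z != x & z != y] by rewrite ![_ == x]eq_sym [z == y]eq_sym.
rewrite /ddot dprecDl dsuccDr.
do !apply: DDD.
- by apply: (@DD3_monomial (MSucc (MGen x) (MSucc (MGen y) (MGen z))));
    rewrite /= ?inE ?negb_or ?xy ?yx ?xz ?zx ?yz ?zy.
- by apply: (@DD3_monomial (MSucc (MGen x) (MPrec (MGen z) (MGen y))));
    rewrite /= ?inE ?negb_or ?xy ?yx ?xz ?zx ?yz ?zy.
- by apply: (@DD3_monomial (MPrec (MSucc (MGen y) (MGen z)) (MGen x)));
    rewrite /= ?inE ?negb_or ?xy ?yx ?xz ?zx ?yz ?zy.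
- by apply: (@DD3_monomial (MPrec (MPrec (MGen z) (MGen y)) (MGen x)));
    rewrite /= ?inE ?negb_or ?xy ?yx ?xz ?zx ?yz ?zy.
Qed.

Lemma f1_DD : DD f1.
Proof.
apply: DDB; [apply: DDD; [apply: DD_ddotl|apply: DD_ddotr]|apply: DD_ddotl];
  by rewrite /= !inE -!val_eqE /= !inordK.
Qed.

Lemma f2_DD : DD f2.
Proof.
apply: DDB; [apply: DDD; [apply: DD_ddotl|apply: DD_ddotr]|apply: DD_ddotr];
  by rewrite /= !inE -!val_eqE /= !inordK.
Qed.

Definition J : FD -> Prop := Sn_generated (fun v => v = f1 \/ v = f2).

Lemma J_submodule : Sn_submodule J.
Proof.
by apply: Sn_generated_submodule => v [->|->]; [apply: f1_DD|apply: f2_DD].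
Qed.

Definition orbit_elt (p : bool * 'S_3) : FD :=
  perm_act p.2 (if p.1 then f2 else f1).

End Degree3.

(* Main.v *)
Require Import Defs.
From HB Require Import structures.
From mathcomp Require Import perm.
From mathcomp Require Import all_boot all_order all_algebra.
From mathcomp Require Import boolp functions ring.

(** The spanning set of [J] given by the 12 elements of the orbits is obtained
    from the morphism property of the [S_3]-action.  Their independence is
    tested in the free dendriform dialgebra truncated in degrees above 3, whose
    degree 3 part has five basis elements for each word [i j k]: there, explicit
    integer combinations of coordinates send [x, y, z] of degree 1 to
    [4 x_i y_j z_k] on one operation and to [0] on the other.  Inverting 2 is
    unavoidable: the 12 elements are dependent in characteristic 2. *)

Set Implicit Arguments.
Unset Strict Implicit.
Unset Printing Implicit Defensive.

Import GRing.Theory.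
Local Open Scope ring_scope.

Lemma linear_comb (F : fieldType) (V W : lmodType F) (I : finType)
    (f : V -> W) (c : I -> F) (e : I -> V) :
  linear f -> f (\sum_i c i *: e i) = \sum_i c i *: f (e i).
Proof.
move=> flin.
pose g : {linear V -> W} := HB.pack f (GRing.isLinear.Build _ _ _ _ f flin).
rewrite -[f]/(g : V -> W) linear_sum; apply: eq_bigr => i _; exact: linearZ.
Qed.

(** * Linear algebra: dual families, bases and spans *)

Section LinearAlgebra.
Variables (F : fieldType) (V : lmodType F) (I : finType).

(** Applying [l i] to a vanishing combination leaves [k * c i = 0]. The common factor [k] lets the
    dual forms keep integer coefficients. *)
Lemma lin_indep_dual (e : I -> V) (l : I -> V -> F^o) (k : F) :
  k != 0 -> (forall i, linear (l i)) ->
  (forall i j, l i (e j) = k * (j == i)%:R) -> lin_indep e.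
Proof.
move=> k0 llin le c ce0 i.
have l0 : l i 0 = 0.
  by have := llin i (-1) 0 0; rewrite scaleN1r addNr scaleN1r addNr.
have : l i (\sum_j c j *: e j) = 0 by rewrite ce0.
rewrite (linear_comb _ _ (llin i)) (bigD1 i) //= big1 => [|j /negPf ji].
  rewrite addr0 le eqxx mulr1 => /eqP; rewrite mulf_eq0 (negPf k0) orbF.
  by move/eqP.
by rewrite le ji mulr0 scaler0.
Qed.

Lemma has_dim_basis (P : V -> Prop) (e : I -> V) :
  lin_indep e -> (forall v, P v <-> exists c : I -> F, v = \sum_i c i *: e i) ->
  has_dim P #|I|.
Proof.
move=> ei Pe.
have sumE (c : 'I_#|I| -> F) :
    \sum_i c i *: e (enum_val i) = \sum_i c (enum_rank i) *: e i.
  rewrite (reindex enum_rank) /=; last exact/onW_bij/enum_rank_bij.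
  by apply: eq_bigr => i _; rewrite enum_rankK.
exists (e \o enum_val); split=> [c|v] /=.
  rewrite sumE => /(ei (c \o enum_rank)) c0 i.
  by rewrite -[i]enum_valK; apply: c0.
split=> [/Pe[c ->]|[c ->]].
  exists (c \o enum_val); rewrite sumE.
  by apply: eq_bigr => i _; rewrite /= enum_rankK.
by rewrite sumE; apply/Pe; exists (c \o enum_rank).
Qed.

Lemma subspace_comb (P : V -> Prop) (c : I -> F) (e : I -> V) :
  subspace P -> (forall i, P (e i)) -> P (\sum_i c i *: e i).
Proof.
move=> [P0 Plin] Pe; elim/big_rec: _ => [//|i v _ Pv].
exact: Plin.
Qed.

Lemma comb_subspace (e : I -> V) :
  subspace (fun v => exists c : I -> F, v = \sum_i c i *: e i).
Proof.
split=> [|k u v [c ->] [d ->]].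
  by exists (fun=> 0); rewrite big1 // => i _; rewrite scale0r.
exists (fun i => k * c i + d i); rewrite scaler_sumr -big_split /=.
by apply: eq_bigr => i _; rewrite scalerA scalerDl.
Qed.

Lemma comb_elt (e : I -> V) (i : I) :
  exists c : I -> F, e i = \sum_j c j *: e j.
Proof.
exists (fun j => (j == i)%:R).
rewrite (bigD1 i) //= eqxx scale1r big1 ?addr0 // => j /negPf ->.
by rewrite scale0r.
Qed.

End LinearAlgebra.

(* Basis of the free dendriform dialgebra in degrees at most 3; [Wpp x y z] is
   [x ≺ (y ≺ z)], [Wps] is [x ≺ (y ≻ z)], [Wsp] is [(x ≻ y) ≺ z], [Wss] is
   [(x ≻ y) ≻ z] and [Wpsl] is [(x ≺ y) ≻ z]. *)
Inductive word (X : Type) : Type :=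
| Wgen of X
| Wprec of X & X
| Wsucc of X & X
| Wpp of X & X & X
| Wps of X & X & X
| Wsp of X & X & X
| Wss of X & X & X
| Wpsl of X & X & X.

(** * The truncated model and its dual forms *)

Section Truncation.
Variables (F : fieldType) (X : Type).

Definition trunc : Type := word X -> F^o.
HB.instance Definition _ := GRing.Lmodule.on trunc.
Implicit Types u v w : trunc.

(** Each coordinate collects the pairs of words whose product, rewritten in the basis, contains [t].
    Since [(x ≺ y) ≺ z] expands into two basis words, the same summand occurs at [Wpp] and at
    [Wps]. *)
Definition tprec u v : trunc := fun t =>
  match t with
  | Wgen _ | Wsucc _ _ | Wss _ _ _ | Wpsl _ _ _ => 0
  | Wprec x y => u (Wgen x) * v (Wgen y)
  | Wpp x y z => u (Wgen x) * v (Wprec y z) + u (Wprec x y) * v (Wgen z)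
  | Wps x y z => u (Wgen x) * v (Wsucc y z) + u (Wprec x y) * v (Wgen z)
  | Wsp x y z => u (Wsucc x y) * v (Wgen z)
  end.

Definition tsucc u v : trunc := fun t =>
  match t with
  | Wgen _ | Wprec _ _ | Wpp _ _ _ | Wps _ _ _ => 0
  | Wsucc x y => u (Wgen x) * v (Wgen y)
  | Wsp x y z => u (Wgen x) * v (Wprec y z)
  | Wss x y z => u (Wsucc x y) * v (Wgen z) + u (Wgen x) * v (Wsucc y z)
  | Wpsl x y z => u (Wprec x y) * v (Wgen z) + u (Wgen x) * v (Wsucc y z)
  end.

Lemma truncD u v t : (u + v) t = u t + v t. Proof. by []. Qed.
Lemma truncN u t : (- u) t = - u t. Proof. by []. Qed.
Lemma truncZ (k : F) u t : (k *: u) t = k * u t. Proof. by []. Qed.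
Let tE := (truncD, truncN, truncZ).

Lemma regular_scaleE (k : F) (x : F^o) : k *: x = (k * x : F). Proof. by []. Qed.

Fact tprec_linl v : linear (tprec^~ v).
Proof. by move=> k u w; apply/funext => -[] *; rewrite !tE /= ?tE; ring. Qed.
Fact tprec_linr u : linear (tprec u).
Proof. by move=> k v w; apply/funext => -[] *; rewrite !tE /= ?tE; ring. Qed.
Fact tsucc_linl v : linear (tsucc^~ v).
Proof. by move=> k u w; apply/funext => -[] *; rewrite !tE /= ?tE; ring. Qed.
Fact tsucc_linr u : linear (tsucc u).
Proof. by move=> k v w; apply/funext => -[] *; rewrite !tE /= ?tE; ring. Qed.
Fact tsucc_prec u v w : tprec (tsucc u v) w = tsucc u (tprec v w).
Proof. by apply/funext => -[] *; rewrite /=; ring. Qed.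
Fact tprec_prec u v w :
  tprec (tprec u v) w = tprec u (tprec v w) + tprec u (tsucc v w).
Proof. by apply/funext => -[] *; rewrite !tE /=; ring. Qed.
Fact tsucc_succ u v w :
  tsucc u (tsucc v w) = tsucc (tsucc u v) w + tsucc (tprec u v) w.
Proof. by apply/funext => -[] *; rewrite !tE /=; ring. Qed.

HB.instance Definition _ := isDendriform.Build F trunc
  tprec_linl tprec_linr tsucc_linl tsucc_linr tsucc_prec tprec_prec tsucc_succ.

(* Found by inverting the 12 x 30 integer matrix of the orbit elements. *)
Definition dual1 (i j k : X) u : F :=
  u (Wpp i j k) - 2 * u (Wpp k j i) + u (Wps i k j)
  + 4 * u (Wsp i j k) + u (Wsp j k i) - 3 * u (Wsp k i j)
  - u (Wss j i k) - 2 * u (Wss i k j) + 2 * u (Wss j k i)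
  + 3 * u (Wpsl i j k) - 2 * u (Wpsl k i j).

Definition dual2 (i j k : X) u : F :=
  2 * u (Wpp i j k) + u (Wpp k j i) + 2 * u (Wps j k i) - 2 * u (Wps k j i)
  + u (Wsp i k j) - 3 * u (Wsp k j i) + u (Wss i k j)
  + u (Wpsl j i k) + u (Wpsl k i j) - 2 * u (Wpsl j k i).

Lemma dual1_linear i j k : linear (dual1 i j k : trunc -> F^o).
Proof. by move=> a u v; rewrite /dual1 !tE regular_scaleE; ring. Qed.
Lemma dual2_linear i j k : linear (dual2 i j k : trunc -> F^o).
Proof. by move=> a u v; rewrite /dual2 !tE regular_scaleE; ring. Qed.

Definition tdeg1 (f : X -> F) : trunc := fun t => if t is Wgen x then f x else 0.

Section Degree1.
Variables (f g h : X -> F) (i j k : X).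

Local Ltac dual_tac :=
  rewrite /dual1 /dual2 /op1 /op2 /ddot /dprec /dsucc /= !tE /= ?tE /=; ring.

(** For generic degree 1 arguments this is a polynomial identity with integer coefficients, so
    [ring] settles all permutations at once. *)
Lemma dual1_op1 :
  dual1 i j k (op1 (tdeg1 f) (tdeg1 g) (tdeg1 h)) = 4 * (f i * g j * h k).
Proof. dual_tac. Qed.
Lemma dual1_op2 : dual1 i j k (op2 (tdeg1 f) (tdeg1 g) (tdeg1 h)) = 0.
Proof. dual_tac. Qed.
Lemma dual2_op1 : dual2 i j k (op1 (tdeg1 f) (tdeg1 g) (tdeg1 h)) = 0.
Proof. dual_tac. Qed.
Lemma dual2_op2 :
  dual2 i j k (op2 (tdeg1 f) (tdeg1 g) (tdeg1 h)) = 4 * (f i * g j * h k).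
Proof. dual_tac. Qed.

End Degree1.
End Truncation.

Section Morphism.
Variables (F : fieldType) (D E : dendriformType F) (f : D -> E).
Hypothesis fM : dendriform_morphism f.

Lemma morph_add (x y : D) : f (x + y) = f x + f y.
Proof. by have [flin _ _] := fM; rewrite -[x]scale1r flin !scale1r. Qed.

Lemma morph_opp (x : D) : f (- x) = - f x.
Proof.
have [flin _ _] := fM.
have f0 : f 0 = 0.
  by have := flin (-1) 0 0; rewrite scaleN1r addNr scaleN1r addNr.
by have := flin (-1) x 0; rewrite f0 !addr0 !scaleN1r.
Qed.

Lemma morph_ddot (x y : D) : f (ddot x y) = ddot (f x) (f y).
Proof. by have [_ fP fS] := fM; rewrite /ddot morph_add fP fS. Qed.

Let morphE := (morph_opp, morph_add, morph_ddot).

Lemma morph_op1 (x y z : D) : f (op1 x y z) = op1 (f x) (f y) (f z).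
Proof. by rewrite /op1 !morphE. Qed.

Lemma morph_op2 (x y z : D) : f (op2 x y z) = op2 (f x) (f y) (f z).
Proof. by rewrite /op2 !morphE. Qed.

End Morphism.

(** * The two orbits: spanning and independence *)

Section Orbits.
Variable F : fieldType.
Local Notation FD := (free_dendriform F 'I_3).

Lemma orbit_eltE (b : bool) (s : 'S_3) :
  orbit_elt F (b, s) =
    (if b then @op2 F FD else @op1 F FD)
      (fgen (s (inord 0))) (fgen (s (inord 1))) (fgen (s (inord 2))).
Proof.
have fM := free_lift_morphism (fun i => fgen (s i) : FD).
by case: b; rewrite /orbit_elt /perm_act /= (morph_op1 fM, morph_op2 fM)
  ?/ga ?/gb ?/gc !free_lift_gen.
Qed.

(** Products in ['S_3] compose from left to right, hence [p.2 * s]. *)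
Lemma perm_act_orbit (s : 'S_3) (p : bool * 'S_3) :
  perm_act s (orbit_elt F p) = orbit_elt F (p.1, (p.2 * s)%g).
Proof.
case: p => b t; have fM := free_lift_morphism (fun i => fgen (s i) : FD).
rewrite !orbit_eltE /perm_act !permM.
by case: b; rewrite (morph_op1 fM, morph_op2 fM) !free_lift_gen.
Qed.

Lemma orbit_elt1 (b : bool) : orbit_elt F (b, 1%g) = if b then f2 F else f1 F.
Proof. by rewrite orbit_eltE !perm1; case: b. Qed.

Lemma J_orbit (v : FD) :
  J v <-> exists c : bool * 'S_3 -> F, v = \sum_p c p *: orbit_elt F p.
Proof.
have [Jsub _ JS] := J_submodule F.
split=> [Jv|[c ->]]; last first.
  apply: subspace_comb => // -[b s]; apply: JS.
  by move=> P _; apply; case: b; [right|left].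
have [DDsub _ DDS] := DD_submodule F 3.
(* [J] is the least submodule containing both operations, so it suffices that the combinations of
   orbit elements form one. *)
apply: (Jv (fun v =>
    exists c : bool * 'S_3 -> F, v = \sum_p c p *: orbit_elt F p)); last first.
  by move=> _ [->|->]; [rewrite -(orbit_elt1 false)|rewrite -(orbit_elt1 true)];
    exact: comb_elt.
split=> [|_ [c ->]|s _ [c ->]].
- exact: comb_subspace.
- apply: subspace_comb => // -[b s]; apply: DDS.
  by case: b; [apply: f2_DD|apply: f1_DD].
- have [flin _ _] := free_lift_morphism (fun i => fgen (s i) : FD).
  rewrite [perm_act s _](linear_comb _ _ flin).
  apply: (subspace_comb _ (comb_subspace _)) => p.
  rewrite -/(perm_act s _) perm_act_orbit; exact: comb_elt.
Qed.

(** The boolean form matches the product of three Kronecker symbols given by the dual forms. *)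
Lemma perm3_eq (s t : 'S_3) :
  (s (inord 0) == t (inord 0)) && (s (inord 1) == t (inord 1))
    && (s (inord 2) == t (inord 2)) = (s == t).
Proof.
apply/idP/eqP => [/andP[/andP[/eqP e0 /eqP e1] /eqP e2]|->];
  last by rewrite !eqxx.
apply/perm.permP => i; rewrite -[i]inord_val.
by case: i => -[|[|[|//]]].
Qed.

Lemma orbit_elt_indep : [pchar F] =i pred0 -> lin_indep (orbit_elt F).
Proof.
move=> charF0.
pose phi : FD -> trunc F 'I_3 :=
  free_lift (fun i => tdeg1 (fun j => (i == j)%:R)).
have phiM : dendriform_morphism phi by apply: free_lift_morphism.
(* The form dual to [(b, s)]: [b] selects the operation, and the indices are permuted by [s]. *)
pose l (p : bool * 'S_3) (v : FD) : F^o :=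
  (if p.1 then @dual2 F 'I_3 else @dual1 F 'I_3)
    (p.2 (inord 0)) (p.2 (inord 1)) (p.2 (inord 2)) (phi v).
(* The factor 4 comes from [dual1_op1] and [dual2_op2]; it is nonzero in characteristic 0. *)
apply: (@lin_indep_dual _ _ _ _ l 4) => [|[b s] k u v|[b s] [b' t]].
- by rewrite ((pcharf0P F).1 charF0).
- have [philin _ _] := phiM; rewrite /l philin.
  by case: b; [apply: dual2_linear|apply: dual1_linear].
- rewrite /l orbit_eltE -pair_eqE /pair_eq /= -[t == s]perm3_eq.
  case: b; case: b'; rewrite /= (morph_op1 phiM, morph_op2 phiM) /phi !free_lift_gen;
    rewrite (dual1_op1, dual1_op2, dual2_op1, dual2_op2) ?mulr0 //;
    by rewrite -!natrM !mulnb.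
Qed.

End Orbits.

Theorem lemma5p1 (F : fieldType) (charF0 : [pchar F]%R =i pred0) :
  has_dim (@J F) 12 /\ lin_indep (@orbit_elt F).
Proof.
have indep := orbit_elt_indep charF0; split=> //.
have -> : 12%N = #|{: bool * 'S_3}| by rewrite card_prod card_bool card_Sn.
exact: has_dim_basis indep (@J_orbit F).
Qed.
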